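(* Let $\Omega=\mathcal V/\!\leftrightarrow$, and for $\bar x,\bar y\in\Omega$, $a\in\mathbb R$ set $\bar x\,\vec{+}\,\bar y:=\overline{x\,\vec{+}\,y}$, $\bar x\,\vec{\vdash}\,\bar y:=\overline{x\,\vec{\vdash}\,y}$, $a\bar x:=\overline{ax}$. Then: (1) these operations are well defined (independent of the choice of representatives); (2) $\Omega$ with this addition/subtraction and scalar product is a vector space over $\mathbb R$.
   Context: $\mathcal V=\bigcup_{n=1}^\infty \mathbb R^n$ (disjoint union, column vectors). $\mathbf 1_k\in\mathbb R^k$ is the all-ones vector, $\otimes$ the Kronecker product. For $x\in\mathbb R^m$, $y\in\mathbb R^n$ and $t=\mathrm{lcm}(m,n)$: $x\,\vec{+}\,y:=(x\otimes \mathbf 1_{t/m})+(y\otimes \mathbf 1_{t/n})\in\mathbb R^t$; $x\,\vec{\vdash}\,y:=x\,\vec{+}\,(-y)$; $ax$ is the usual scalar multiple. $x\leftrightarrow y$ means there exist positive integers $\alpha,\beta$ with $x\otimes \mathbf 1_\alpha=y\otimes \mathbf 1_\beta$; this is an equivalence relation on $\mathcal V$, and $\bar x$ denotes the equivalence class of $x$. *)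

(* Defs.v *)
From HB Require Import structures.
From mathcomp Require Import all_boot all_order all_algebra.
From mathcomp Require Import generic_quotient.
From mathcomp Require Import boolp reals.
From mathcomp Require Import mxtens.

Set Implicit Arguments.
Unset Strict Implicit.
Unset Printing Implicit Defensive.

Import GRing.Theory.
Local Open Scope ring_scope.

(* The disjoint union of the spaces R^n, n >= 1. *)
Record vecs (R : realType) := Vecs {
  dim : nat;
  dim_gt0 : (0 < dim)%N;
  coords :> 'cV[R]_dim }.

HB.instance Definition _ (R : realType) := gen_eqMixin (vecs R).
HB.instance Definition _ (R : realType) := gen_choiceMixin (vecs R).

Lemma muln_gt0_pair (m n : nat) : (0 < m)%N -> (0 < n)%N -> (0 < m * n)%N.
Proof. by rewrite muln_gt0 => -> ->. Qed.

Lemma lcmn_gt0_pair (m n : nat) : (0 < m)%N -> (0 < n)%N -> (0 < lcmn m n)%N.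
Proof. by rewrite lcmn_gt0 => -> ->. Qed.

Lemma mul_divn_lcml (m n : nat) : (m * (lcmn m n %/ m))%N = lcmn m n.
Proof. by rewrite mulnC divnK ?dvdn_lcml. Qed.

Lemma mul_divn_lcmr (m n : nat) : (n * (lcmn m n %/ n))%N = lcmn m n.
Proof. by rewrite mulnC divnK ?dvdn_lcmr. Qed.

(* The Kronecker product x (x) 1_k; the column count 1 * 1 produced by [tensmx]
   is convertible to 1. *)
Definition kron1 (R : realType) (m : nat) (x : 'cV[R]_m) (k : nat) :
  'cV[R]_(m * k) := x *t (const_mx 1 : 'cV[R]_k).

Definition vkron1 (R : realType) (x : vecs R) (k : nat) (k_gt0 : (0 < k)%N) :
  vecs R := Vecs (muln_gt0_pair (dim_gt0 x) k_gt0) (kron1 x k).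

Definition vadd (R : realType) (x y : vecs R) : vecs R :=
  let t := lcmn (dim x) (dim y) in
  Vecs (lcmn_gt0_pair (dim_gt0 x) (dim_gt0 y))
    (castmx (mul_divn_lcml (dim x) (dim y), erefl) (kron1 x (t %/ dim x)) +
     castmx (mul_divn_lcmr (dim x) (dim y), erefl) (kron1 y (t %/ dim y))).

Definition vopp (R : realType) (x : vecs R) : vecs R :=
  Vecs (dim_gt0 x) (- coords x).

Definition vsub (R : realType) (x y : vecs R) : vecs R := vadd x (vopp y).

Definition vscale (R : realType) (a : R) (x : vecs R) : vecs R :=
  Vecs (dim_gt0 x) (a *: coords x).

(* The equality is between elements of the disjoint union, so it includes
   the equality of dimensions. *)
Definition vequiv (R : realType) (x y : vecs R) : Prop :=
  exists (a b : nat) (a_gt0 : (0 < a)%N) (b_gt0 : (0 < b)%N),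
    vkron1 x a_gt0 = vkron1 y b_gt0.

Lemma vkron1A (R : realType) (x : vecs R) (a b : nat)
    (a_gt0 : (0 < a)%N) (b_gt0 : (0 < b)%N) (ab_gt0 : (0 < a * b)%N) :
  vkron1 (vkron1 x a_gt0) b_gt0 = vkron1 x ab_gt0.
Proof.
case: x => m m_gt0 x; rewrite /vkron1 /=.
move: (muln_gt0_pair _ _) (muln_gt0_pair _ _) => p q.
have E : (m * a * b = m * (a * b))%N by rewrite mulnA.
have -> : kron1 x (a * b) = castmx (E, erefl) (kron1 (kron1 x a) b).
  apply/matrixP=> i j; rewrite castmxE /kron1 /tensmx !mxE !mulr1.
  by congr (x _ _); [|rewrite !ord1]; apply: val_inj; rewrite //= -divnMA [(b * a)%N]mulnC.
by case: _ / E p => p; rewrite castmx_id (bool_irrelevance p q).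
Qed.

Lemma vkron1AC (R : realType) (x : vecs R) (a b : nat)
    (a_gt0 : (0 < a)%N) (b_gt0 : (0 < b)%N) :
  vkron1 (vkron1 x a_gt0) b_gt0 = vkron1 (vkron1 x b_gt0) a_gt0.
Proof.
have ab_gt0 := muln_gt0_pair a_gt0 b_gt0.
have ba_gt0 := muln_gt0_pair b_gt0 a_gt0.
rewrite (vkron1A _ _ _ ab_gt0) (vkron1A _ _ _ ba_gt0).
by move: ba_gt0; rewrite mulnC => ba_gt0; congr vkron1; apply: bool_irrelevance.
Qed.

Lemma vequiv_refl (R : realType) : reflexive (fun x y : vecs R => `[< vequiv x y >]).
Proof. by move=> x; apply/asboolP; exists 1%N, 1%N, isT, isT. Qed.

Lemma vequiv_sym (R : realType) : symmetric (fun x y : vecs R => `[< vequiv x y >]).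
Proof.
by move=> x y; apply/asboolP/asboolP => -[a [b [a0 [b0 e]]]]; exists b, a, b0, a0.
Qed.

Lemma vequiv_trans (R : realType) : transitive (fun x y : vecs R => `[< vequiv x y >]).
Proof.
move=> y x z /asboolP[a [b [a0 [b0 e]]]] /asboolP[c [d [c0 [d0 f]]]].
apply/asboolP; have ac0 := muln_gt0_pair a0 c0; have db0 := muln_gt0_pair d0 b0.
exists (a * c)%N, (d * b)%N, ac0, db0.
by rewrite -(vkron1A x a0 c0) -(vkron1A z d0 b0) e -f vkron1AC.
Qed.

Definition vequiv_rel (R : realType) : equiv_rel (vecs R) :=
  EquivRel (fun x y : vecs R => `[< vequiv x y >])
    (@vequiv_refl R) (@vequiv_sym R) (@vequiv_trans R).

Definition Omega (R : realType) : Type := {eq_quot vequiv_rel R}%qT.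

Definition vclass (R : realType) (x : vecs R) : Omega R :=
  (\pi_{eq_quot vequiv_rel R} x)%qT.

(* Main.v *)
(** A vector [x] in R^m is the step function on [0, 1) taking the value [x_i] on
    [i/m, (i+1)/m).  Tensoring with an all-ones vector only refines the
    subdivision, so two vectors are equivalent exactly when their step functions
    agree at the rationals, and the operations become pointwise ones.  Hence
    Omega embeds in a space of functions, from which it inherits the vector
    space axioms. *)

From HB Require Import structures.
From mathcomp Require Import all_boot all_order all_algebra.
From mathcomp Require Import generic_quotient boolp mxtens.
From mathcomp Require Import reals.
Require Import Defs.

Set Implicit Arguments.
Unset Strict Implicit.
Unset Printing Implicit Defensive.

Import GRing.Theory.
Local Open Scope ring_scope.

(* Extended by 0 beyond the dimension. *)
Definition entry (R : realType) (x : vecs R) (i : nat) : R :=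
  if insub i is Some j then coords x j 0 else 0.

Lemma entry_ord (R : realType) (x : vecs R) (j : 'I_(dim x)) :
  entry x j = coords x j 0.
Proof. by rewrite /entry valK. Qed.

Lemma entry_ge (R : realType) (x : vecs R) (i : nat) :
  (dim x <= i)%N -> entry x i = 0.
Proof. by move=> le_xi; rewrite /entry insubF // ltnNge le_xi. Qed.

Lemma entry_inj (R : realType) (x y : vecs R) :
  dim x = dim y -> entry x =1 entry y -> x = y.
Proof.
case: x y => m m_gt0 x [n n_gt0 y] /= eq_mn.
case: _ / eq_mn n_gt0 y => n_gt0 y eq_xy.
have -> : x = y.
  apply/matrixP=> i j; rewrite !ord1.
  have := eq_xy i.
  by rewrite (@entry_ord R (Vecs m_gt0 x)) (@entry_ord R (Vecs n_gt0 y)).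
by rewrite (bool_irrelevance m_gt0 n_gt0).
Qed.

(** Row [i] of a Kronecker product pairs rows [i %/ k] and [i %% k] of its factors, and the second
    factor contributes only 1. Past the end, both sides take the default 0. *)
Lemma entry_vkron1 (R : realType) (x : vecs R) (k : nat) (k_gt0 : (0 < k)%N) i :
  entry (vkron1 x k_gt0) i = entry x (i %/ k).
Proof.
have [lt_i|ge_i] := ltnP i (dim x * k); last first.
  by rewrite !entry_ge // leq_divRL.
rewrite (@entry_ord R (vkron1 x k_gt0) (Ordinal lt_i)) /= /kron1 /tensmx !mxE mulr1.
have lt_ik : (i %/ k < dim x)%N by rewrite ltn_divLR.
rewrite (@entry_ord R x (Ordinal lt_ik)).
by congr (coords x _ _); [apply: val_inj | rewrite ord1].
Qed.

Lemma divn_lcml_gt0 m n : (0 < m)%N -> (0 < n)%N -> (0 < lcmn m n %/ m)%N.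
Proof.
by move=> m_gt0 n_gt0; rewrite divn_gt0 // dvdn_leq ?dvdn_lcml // lcmn_gt0 m_gt0.
Qed.

Lemma entry_vadd (R : realType) (x y : vecs R) (i : nat) :
  let t := lcmn (dim x) (dim y) in
  entry (vadd x y) i = entry x (i %/ (t %/ dim x)) + entry y (i %/ (t %/ dim y)).
Proof.
move=> t; have tx_gt0 : (0 < t %/ dim x)%N by rewrite divn_lcml_gt0 ?dim_gt0.
have ty_gt0 : (0 < t %/ dim y)%N by rewrite /t lcmnC divn_lcml_gt0 ?dim_gt0.
have [lt_i|ge_i] := ltnP i t; last first.
  (* For [t <= i], both quotient indices are at least the respective dimensions, so all three
     entries are 0. *)
  rewrite !entry_ge ?addr0 // leq_divRL //.
    by rewrite mul_divn_lcmr.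
  by rewrite mul_divn_lcml.
rewrite (@entry_ord R (vadd x y) (Ordinal lt_i)) /= !mxE !castmxE.
(* Read as entries of [vkron1], the summands depend only on the natural number [i], which the casts
   preserve. *)
rewrite -(entry_vkron1 _ tx_gt0) -(entry_vkron1 _ ty_gt0) !ord1.
congr (_ + _); first by rewrite -(@entry_ord R (vkron1 x tx_gt0)).
by rewrite -(@entry_ord R (vkron1 y ty_gt0)).
Qed.

Lemma entry_vopp (R : realType) (x : vecs R) i : entry (vopp x) i = - entry x i.
Proof. by rewrite /entry /=; case: insub => [j|]; rewrite ?mxE ?oppr0. Qed.

Lemma entry_vscale (R : realType) (a : R) (x : vecs R) i :
  entry (vscale a x) i = a * entry x i.
Proof. by rewrite /entry /=; case: insub => [j|]; rewrite ?mxE ?mulr0. Qed.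

(* The step function of [x] at the rational p / (q + 1); it vanishes from 1 on. *)
Definition profile (R : realType) (x : vecs R) (p q : nat) : R :=
  entry x ((dim x * p) %/ q.+1).

(** Nested floors merge and [k] cancels: the piece of the [k]-fold refinement containing a point
    lies in the coarse piece containing it. *)
Lemma divn_refine (m k p q : nat) :
  (0 < k)%N -> ((m * k * p) %/ q %/ k = (m * p) %/ q)%N.
Proof. by move=> k_gt0; rewrite -divnMA mulnAC divnMr. Qed.

Lemma profile_vkron1 (R : realType) (x : vecs R) k (k_gt0 : (0 < k)%N) p q :
  profile (vkron1 x k_gt0) p q = profile x p q.
Proof. by rewrite /profile entry_vkron1 divn_refine. Qed.

Lemma profile_vadd (R : realType) (x y : vecs R) p q :
  profile (vadd x y) p q = profile x p q + profile y p q.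
Proof.
rewrite /profile entry_vadd /=; set t := lcmn _ _.
have tx_gt0 : (0 < t %/ dim x)%N by rewrite divn_lcml_gt0 ?dim_gt0.
have ty_gt0 : (0 < t %/ dim y)%N by rewrite /t lcmnC divn_lcml_gt0 ?dim_gt0.
(* Each operand is sampled through the common subdivision into [t] pieces, where the sum is
   formed. *)
rewrite -(divn_refine (dim x) p q.+1 tx_gt0) mul_divn_lcml.
by rewrite -(divn_refine (dim y) p q.+1 ty_gt0) mul_divn_lcmr.
Qed.

Lemma profile_vopp (R : realType) (x : vecs R) p q :
  profile (vopp x) p q = - profile x p q.
Proof. by rewrite /profile entry_vopp. Qed.

Lemma profile_vsub (R : realType) (x y : vecs R) p q :
  profile (vsub x y) p q = profile x p q - profile y p q.
Proof. by rewrite profile_vadd profile_vopp. Qed.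

Lemma profile_vscale (R : realType) (a : R) (x : vecs R) p q :
  profile (vscale a x) p q = a * profile x p q.
Proof. by rewrite /profile entry_vscale. Qed.

Lemma vequivP (R : realType) (x y : vecs R) :
  vequiv x y <-> profile x =2 profile y.
Proof.
split=> [[a [b [a_gt0 [b_gt0 eq_xy]]]] p q|eq_xy].
  by rewrite -(profile_vkron1 x a_gt0) eq_xy profile_vkron1.
(* Cross-multiplying brings both vectors to dimension [dim x * dim y]. *)
exists (dim y), (dim x), (dim_gt0 y), (dim_gt0 x).
apply: entry_inj => [|i]; first by rewrite /= mulnC.
rewrite !entry_vkron1.
(* Sampling at [i / (dim x * dim y)] reads off row [i] of both refinements; the predecessor
   compensates for the [q.+1] in [profile]. *)
have := eq_xy i (dim x * dim y).-1; rewrite /profile prednK.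
  by rewrite divnMl ?dim_gt0 // (mulnC (dim x) (dim y)) divnMl ?dim_gt0.
by rewrite muln_gt0 !dim_gt0.
Qed.

Lemma vclassP (R : realType) (x y : vecs R) :
  vclass x = vclass y <-> profile x =2 profile y.
Proof.
rewrite -vequivP; split=> [/eqmodP/asboolP //|eq_xy].
by apply/eqmodP/asboolP.
Qed.

HB.instance Definition _ (R : realType) :=
  Choice.copy (Omega R) {eq_quot vequiv_rel R}%qT.

Definition vrepr (R : realType) (u : Omega R) : vecs R :=
  repr (u : {eq_quot vequiv_rel R}%qT).

Lemma vreprK (R : realType) (u : Omega R) : vclass (vrepr u) = u.
Proof. exact: reprK. Qed.

Lemma profile_vrepr (R : realType) (x : vecs R) :
  profile (vrepr (vclass x)) =2 profile x.
Proof. by apply/vclassP; rewrite vreprK. Qed.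

(** This is the embedding of [Omega] into functions; it reduces each vector space axiom to an
    identity in [R]. *)
Lemma profile_vrepr_inj (R : realType) (u v : Omega R) :
  profile (vrepr u) =2 profile (vrepr v) -> u = v.
Proof. by move/vclassP; rewrite !vreprK. Qed.

(** Zero vectors of all dimensions form one class, represented here in dimension 1. *)
Definition Omega_zero (R : realType) : Omega R :=
  vclass (Vecs (ltn0Sn 0) (0 : 'cV[R]_1)).
Definition Omega_opp (R : realType) (u : Omega R) : Omega R :=
  vclass (vopp (vrepr u)).
Definition Omega_add (R : realType) (u v : Omega R) : Omega R :=
  vclass (vadd (vrepr u) (vrepr v)).
Definition Omega_scale (R : realType) (a : R) (u : Omega R) : Omega R :=
  vclass (vscale a (vrepr u)).

Lemma profile_zero (R : realType) p q :
  profile (vrepr (Omega_zero R)) p q = 0.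
Proof.
by rewrite profile_vrepr /profile /entry /=; case: insub => [j|]; rewrite ?mxE.
Qed.

Definition profileE (R : realType) :=
  (@profile_zero R, @profile_vrepr R, @profile_vadd R, @profile_vopp R,
   @profile_vsub R, @profile_vscale R).

Lemma Omega_addA (R : realType) : associative (@Omega_add R).
Proof. by move=> u v w; apply: profile_vrepr_inj => p q; rewrite !profileE addrA. Qed.

Lemma Omega_addC (R : realType) : commutative (@Omega_add R).
Proof. by move=> u v; apply: profile_vrepr_inj => p q; rewrite !profileE addrC. Qed.

Lemma Omega_add0 (R : realType) : left_id (Omega_zero R) (@Omega_add R).
Proof. by move=> u; apply: profile_vrepr_inj => p q; rewrite !profileE add0r. Qed.

Lemma Omega_addN (R : realType) :
  left_inverse (Omega_zero R) (@Omega_opp R) (@Omega_add R).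
Proof. by move=> u; apply: profile_vrepr_inj => p q; rewrite !profileE addNr. Qed.

HB.instance Definition _ (R : realType) := GRing.isZmodule.Build (Omega R)
  (@Omega_addA R) (@Omega_addC R) (@Omega_add0 R) (@Omega_addN R).

Lemma Omega_scaleA (R : realType) (a b : R) (u : Omega R) :
  Omega_scale a (Omega_scale b u) = Omega_scale (a * b) u.
Proof. by apply: profile_vrepr_inj => p q; rewrite !profileE mulrA. Qed.

Lemma Omega_scale1 (R : realType) : left_id 1 (@Omega_scale R).
Proof. by move=> u; apply: profile_vrepr_inj => p q; rewrite !profileE mul1r. Qed.

Lemma Omega_scaleDr (R : realType) : right_distributive (@Omega_scale R) +%R.
Proof. by move=> a u v; apply: profile_vrepr_inj => p q; rewrite !profileE mulrDr. Qed.

Lemma Omega_scaleDl (R : realType) (u : Omega R) :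
  {morph (@Omega_scale R)^~ u : a b / a + b}.
Proof. by move=> a b; apply: profile_vrepr_inj => p q; rewrite !profileE mulrDl. Qed.

HB.instance Definition _ (R : realType) :=
  GRing.Zmodule_isLmodule.Build R (Omega R)
    (@Omega_scaleA R) (@Omega_scale1 R) (@Omega_scaleDr R) (@Omega_scaleDl R).

Theorem mainTheorem5 (R : realType) :
  [/\ forall x x' y y' : vecs R, vclass x = vclass x' -> vclass y = vclass y' ->
        vclass (vadd x y) = vclass (vadd x' y'),
      forall x x' y y' : vecs R, vclass x = vclass x' -> vclass y = vclass y' ->
        vclass (vsub x y) = vclass (vsub x' y') &
      forall (a : R) (x x' : vecs R), vclass x = vclass x' ->
        vclass (vscale a x) = vclass (vscale a x')] /\
  (exists c : GRing.Lmodule.axioms_ R (Omega R),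
    let W : lmodType R := GRing.Lmodule.Pack c in
    [/\ forall x y : vecs R, (vclass x : W) + (vclass y : W) = vclass (vadd x y),
        forall x y : vecs R, (vclass x : W) - (vclass y : W) = vclass (vsub x y) &
        forall (a : R) (x : vecs R), a *: (vclass x : W) = vclass (vscale a x)]).
Proof.
split.
  (* The profile of each result is determined by the profiles of the operands. *)
  split=> [x x' y y' /vclassP eq_x /vclassP eq_y
          |x x' y y' /vclassP eq_x /vclassP eq_y|a x x' /vclassP eq_x];
    by apply/vclassP => p q; rewrite !profileE ?eq_x ?eq_y.
(* The operations of this structure unfold to [Omega_add], [Omega_opp] and [Omega_scale], so
   [profileE] evaluates them on chosen representatives. *)
exists (GRing.Lmodule.class (Omega R : lmodType R)) => W.
split=> [x y|x y|a x].
- by apply/vclassP => p q; rewrite !profileE.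
- by apply/vclassP => p q; rewrite !profileE.
- by apply/vclassP => p q; rewrite !profileE.
Qed.
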